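(* Let $G=(V,E)$ be a finite undirected weighted graph with $V=\{1,\dots,n\}$ and all degrees $d_i>0$, let $d\ge1$, let $\rho:E\to O(d)$ be given with $\rho_{ji}=\rho_{ij}^{-1}$, and assume $\lambda_2(\mathcal{L}_0)>0$. Let $z^1,\dots,z^d\in\mathbb{R}^{dn}$ be orthonormal eigenvectors of the normalized graph Connection Laplacian $\mathcal{L}_1$ corresponding to its $d$ smallest eigenvalues $\lambda_1(\mathcal{L}_1)\le\dots\le\lambda_d(\mathcal{L}_1)$, let $x^j=D_1^{-1/2}z^j$ for $j=1,\dots,d$, and for each vertex $i$ let $X_i=[x_i^1\cdots x_i^d]\in\mathbb{R}^{d\times d}$. Define $g:V\to O(d)$ by $g_i=U(X_i)$, where $U(X_i)$ is the orthogonal matrix closest to $X_i$ in Frobenius norm if $X_i$ is nonsingular (that is, $U(X_i)=U_iV_i^T$ for an SVD $X_i=U_i\Sigma_iV_i^T$), and $U(X_i)=I_{d\times d}$ if $X_i$ is singular. Then $$\nu(g)\le 1026\,d^3\,\frac{1}{\lambda_2(\mathcal{L}_0)}\sum_{i=1}^d\lambda_i(\mathcal{L}_1).$$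
   Context: $G$ is a simple graph with symmetric weights $w_{ij}=w_{ji}$, $w_{ij}>0$ if $(i,j)\in E$ and $w_{ij}=0$ otherwise; $d_i=\sum_j w_{ij}$ and $\mathrm{vol}(G)=\sum_i d_i$. $O(d)$ is the group of $d\times d$ real orthogonal matrices. Sums $\sum_{i,j}$ run over all ordered pairs of vertices (terms with $w_{ij}=0$ vanish). For $x\in\mathbb{R}^{dn}$, $x_i\in\mathbb{R}^d$ denotes its $i$-th $d\times1$ block. Graph Laplacian: $W_0=(w_{ij})\in\mathbb{R}^{n\times n}$, $D_0=\mathrm{diag}(d_1,\dots,d_n)$, $\mathcal{L}_0=I-D_0^{-1/2}W_0D_0^{-1/2}$. Connection Laplacian: $W_1\in\mathbb{R}^{dn\times dn}$ is the symmetric matrix whose $(i,j)$-th $d\times d$ block is $w_{ij}\rho_{ij}$, $D_1\in\mathbb{R}^{dn\times dn}$ is block diagonal with $i$-th diagonal block $d_iI_{d\times d}$, and $\mathcal{L}_1=I-D_1^{-1/2}W_1D_1^{-1/2}$. Eigenvalues are listed in increasing order with multiplicity. The $O(d)$ frustration of $g:V\to O(d)$ is $\nu(g)=\frac{1}{2d}\frac{1}{\mathrm{vol}(G)}\sum_{i,j}w_{ij}\|g_i-\rho_{ij}g_j\|_F^2$. *)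

(* Defs.v *)
From mathcomp Require Import all_boot all_order all_algebra.
From mathcomp Require Import boolp classical_sets reals.

Set Implicit Arguments.
Unset Strict Implicit.
Unset Printing Implicit Defensive.

Import Order.TTheory GRing.Theory Num.Theory.
Local Open Scope ring_scope.

(* The eigenvalues of a matrix with real spectrum (for instance a symmetric
   one), in increasing order, with multiplicity: the only sorted list whose
   elements are the roots of the characteristic polynomial. *)
Definition spectrum (R : realType) (m : nat) (A : 'M[R]_m) : seq R :=
  xget [::] [set s : seq R |
    sorted <=%R s /\ char_poly A = \prod_(a <- s) ('X - a%:P)]%classic.

(* 1-based: [eigval A 1] is the smallest eigenvalue. The value is 0 when
   k > m. *)
Definition eigval (R : realType) (m : nat) (A : 'M[R]_m) (k : nat) : R :=
  (spectrum A)`_k.-1.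

Definition frobenius_norm (R : realType) (m p : nat) (A : 'M[R]_(m, p)) : R :=
  Num.sqrt (\sum_i \sum_j A i j ^+ 2).

Definition orthogonal_mx (R : realType) (d : nat) (Q : 'M[R]_d) : Prop :=
  Q^T *m Q = 1%:M.

Definition closest_orthogonal (R : realType) (d : nat) (A Q : 'M[R]_d) : Prop :=
  orthogonal_mx Q /\
  forall P : 'M[R]_d, orthogonal_mx P ->
    frobenius_norm (A - Q) <= frobenius_norm (A - P).

(* The map U. For nonsingular A the closest orthogonal matrix exists and is
   unique, so the default 1%:M of [xget] is never used. *)
Definition round_orthogonal (R : realType) (d : nat) (A : 'M[R]_d) : 'M[R]_d :=
  if A \in unitmx then xget 1%:M [set Q | closest_orthogonal A Q]%classic
  else 1%:M.

Lemma round_orthogonalP (R : realType) (d : nat) (A : 'M[R]_d) :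
  orthogonal_mx (round_orthogonal A).
Proof.
have o1 : orthogonal_mx (1%:M : 'M[R]_d) by rewrite /orthogonal_mx trmx1 mulmx1.
rewrite /round_orthogonal; case: ifP => // _.
by case: xgetP => [Q _ []|].
Qed.

Definition degree (R : realType) (n : nat) (w : 'M[R]_n) (i : 'I_n) : R :=
  \sum_j w i j.

Definition volume (R : realType) (n : nat) (w : 'M[R]_n) : R :=
  \sum_i degree w i.

Definition is_weighted_graph (R : realType) (n : nat)
    (e : rel 'I_n) (w : 'M[R]_n) : Prop :=
  [/\ symmetric e, irreflexive e, forall i j, w i j = w j i,
      forall i j, e i j -> 0 < w i j & forall i j, ~~ e i j -> w i j = 0].

(* An edge map E -> O(d) is represented by a total function on pairs of
   vertices; its values off E are unconstrained, and everywhere below they are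
   multiplied by w i j = 0. *)
Definition is_connection (R : realType) (n d : nat)
    (e : rel 'I_n) (rho : 'I_n -> 'I_n -> 'M[R]_d) : Prop :=
  forall i j, e i j ->
    orthogonal_mx (rho i j) /\ rho j i = invmx (rho i j).

Definition D0_invsqrt (R : realType) (n : nat) (w : 'M[R]_n) : 'M[R]_n :=
  diag_mx (\row_i (Num.sqrt (degree w i))^-1).

Definition graph_laplacian (R : realType) (n : nat) (w : 'M[R]_n) : 'M[R]_n :=
  1%:M - D0_invsqrt w *m w *m D0_invsqrt w.

(* R^(dn) is indexed by the sum of n copies of d, so that the block
   operations of the library apply. *)
Definition W1 (R : realType) (n d : nat) (w : 'M[R]_n)
    (rho : 'I_n -> 'I_n -> 'M[R]_d) : 'M[R]_(\sum_(i < n) d) :=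
  \mxblock_(i < n, j < n) (w i j *: rho i j).

Definition D1_invsqrt (R : realType) (n d : nat) (w : 'M[R]_n) :
    'M[R]_(\sum_(i < n) d) :=
  \mxdiag_(i < n) ((Num.sqrt (degree w i))^-1)%:M.

Definition connection_laplacian (R : realType) (n d : nat) (w : 'M[R]_n)
    (rho : 'I_n -> 'I_n -> 'M[R]_d) : 'M[R]_(\sum_(i < n) d) :=
  1%:M - D1_invsqrt d w *m W1 w rho *m D1_invsqrt d w.

(* X_i = [x^1_i ... x^d_i], with x_i the i-th d x 1 block of x. *)
Definition block_matrix (R : realType) (n d : nat)
    (x : 'I_d -> 'cV[R]_(\sum_(i < n) d)) (i : 'I_n) : 'M[R]_d :=
  \matrix_(a < d, j < d) submxcol (x j) i a 0.

Definition frustration (R : realType) (n d : nat) (w : 'M[R]_n)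
    (rho : 'I_n -> 'I_n -> 'M[R]_d) (g : 'I_n -> 'M[R]_d) : R :=
  (2 * d%:R)^-1 * (volume w)^-1 *
  \sum_i \sum_j w i j * frobenius_norm (g i - rho i j *m g j) ^+ 2.

(* Main.v *)
Require Import Defs.
From mathcomp Require Import all_boot all_order all_algebra.
From mathcomp Require Import boolp classical_sets reals.
From mathcomp Require Import complex ring lra.

(* Let Lam be the sum of the d smallest eigenvalues of L_1, so that
   Lam = 1/2 sum_ij w_ij |X_i - rho_ij X_j|_F^2, and let V = vol(G).  For every
   fixed vector u the norms |X_i u| form a function on the vertices whose
   Dirichlet energy is at most that of X u, and sum_i d_i |X_i u|^2 = |u|^2; by
   the Poincare inequality for L_0 they are close to |u| / sqrt V in mean
   square.  Applying this to all u = e_j + e_k and u = e_j - e_k bounds by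
   72 d^3 V Lam / lambda_2 the volume of the vertices at which the smallest
   singular value of sqrt V X_i is less than 1/2.  Each edge at such a vertex
   contributes at most 4 d w_ij to 2 d V nu(g); on the other edges the polar
   factor is 2-Lipschitz around sqrt V X_i, so these contribute at most
   8 V Lam <= 16 V Lam / lambda_2 altogether. *)

Set Implicit Arguments.
Unset Strict Implicit.
Unset Printing Implicit Defensive.

Import Order.TTheory GRing.Theory Num.Theory.
Local Open Scope ring_scope.

(** * The real spectral theorem *)

(** The Frobenius inner product, which on column vectors is the dot product. *)
Definition mxdot (R : pzSemiRingType) (m p : nat) (A B : 'M[R]_(m, p)) : R :=
  \tr (A^T *m B).

Lemma mxdotE (R : pzSemiRingType) m p (A B : 'M[R]_(m, p)) :
  mxdot A B = \sum_i \sum_j A i j * B i j.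
Proof.
rewrite exchange_big /mxdot /mxtrace; apply: eq_bigr => j _; rewrite mxE.
by apply: eq_bigr => i _; rewrite mxE.
Qed.

Lemma mxdotC (R : comPzRingType) m p (A B : 'M[R]_(m, p)) :
  mxdot A B = mxdot B A.
Proof. by rewrite /mxdot -mxtrace_tr trmx_mul trmxK. Qed.

Lemma mxdotDl (R : pzRingType) m p (A B C : 'M[R]_(m, p)) :
  mxdot (A + B) C = mxdot A C + mxdot B C.
Proof. by rewrite /mxdot raddfD mulmxDl raddfD. Qed.

Lemma mxdotDr (R : pzRingType) m p (A B C : 'M[R]_(m, p)) :
  mxdot A (B + C) = mxdot A B + mxdot A C.
Proof. by rewrite /mxdot mulmxDr raddfD. Qed.

Lemma mxdotNl (R : pzRingType) m p (A B : 'M[R]_(m, p)) :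
  mxdot (- A) B = - mxdot A B.
Proof. by rewrite /mxdot raddfN mulNmx raddfN. Qed.

Lemma mxdotNr (R : pzRingType) m p (A B : 'M[R]_(m, p)) :
  mxdot A (- B) = - mxdot A B.
Proof. by rewrite /mxdot mulmxN raddfN. Qed.

Lemma mxdotZl (R : pzRingType) m p a (A B : 'M[R]_(m, p)) :
  mxdot (a *: A) B = a * mxdot A B.
Proof. by rewrite /mxdot linearZ -scalemxAl linearZ. Qed.

Lemma mxdotZr (R : comPzRingType) m p a (A B : 'M[R]_(m, p)) :
  mxdot A (a *: B) = a * mxdot A B.
Proof. by rewrite /mxdot -scalemxAr linearZ. Qed.

Lemma mxdot_mull (R : comPzRingType) m p q (A : 'M[R]_(m, p)) (B : 'M_(p, q))
    (C : 'M_(m, q)) : mxdot (A *m B) C = mxdot B (A^T *m C).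
Proof. by rewrite /mxdot trmx_mul mulmxA. Qed.

Definition mxdotl := (mxdotDl, mxdotNl, mxdotZl, mxdotDr, mxdotNr, mxdotZr).

Section RealMatrices.
Context {R : rcfType}.
Implicit Types m n p : nat.

Lemma mxdot_ge0 m p (A : 'M[R]_(m, p)) : 0 <= mxdot A A.
Proof. by rewrite mxdotE; do 2![apply: sumr_ge0 => ? _]; rewrite -expr2 sqr_ge0. Qed.

Lemma mxdot_eq0 m p (A : 'M[R]_(m, p)) : (mxdot A A == 0) = (A == 0).
Proof.
apply/idP/eqP => [|->]; last by rewrite /mxdot mulmx0 mxtrace0.
rewrite mxdotE psumr_eq0 => [/allP A0|i _]; last first.
  by apply: sumr_ge0 => j _; rewrite -expr2 sqr_ge0.
apply/matrixP => i j; rewrite mxE; have := A0 i; rewrite mem_index_enum.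
move=> /(_ isT); rewrite psumr_eq0 => [/allP/(_ j)|k _]; last first.
  by rewrite -expr2 sqr_ge0.
by rewrite mem_index_enum -expr2 sqrf_eq0 => /(_ isT)/eqP.
Qed.

Lemma mxdot_gt0 m p (A : 'M[R]_(m, p)) : (0 < mxdot A A) = (A != 0).
Proof. by rewrite lt_neqAle mxdot_ge0 andbT eq_sym mxdot_eq0. Qed.

(* For a complex eigenvector [p + i q] of a real symmetric matrix with
   eigenvalue [a + i b], comparing [q A p] with [p A q] gives
   [b (|p|^2 + |q|^2) = 0]. *)
Lemma symmetric_eigenvector n (A : 'M[R]_n.+1) : A^T = A ->
  exists a (u : 'cV[R]_n.+1), u != 0 /\ A *m u = a *: u.
Proof.
move=> symA.
have [al /eigenvalueP[v vA v0]] :=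
  eigenvalue_closed (map_mx (real_complex R) A) (ltn0Sn n).
pose p := (map_mx (@complex.Re R) v)^T; pose q := (map_mx (@complex.Im R) v)^T.
have ReM (s : seq 'I_n.+1) (f : 'I_n.+1 -> R[i]) (g : 'I_n.+1 -> R) :
    complex.Re (\sum_(k <- s) f k * (real_complex R (g k))) =
    \sum_(k <- s) complex.Re (f k) * g k.
  rewrite raddf_sum; apply: eq_bigr => k _; case: (f k) => x y /=.
  by rewrite mulr0 subr0.
have ImM (s : seq 'I_n.+1) (f : 'I_n.+1 -> R[i]) (g : 'I_n.+1 -> R) :
    complex.Im (\sum_(k <- s) f k * (real_complex R (g k))) =
    \sum_(k <- s) complex.Im (f k) * g k.
  rewrite raddf_sum; apply: eq_bigr => k _; case: (f k) => x y /=.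
  by rewrite mulr0 add0r.
case: al vA => a b vA.
have Ap : A *m p = a *: p - b *: q.
  rewrite -symA -trmx_mul; apply/colP => j; rewrite !mxE.
  have /rowP/(_ j)/(congr1 (@complex.Re R)) := vA.
  rewrite !mxE; under eq_bigr => k _ do rewrite mxE.
  rewrite ReM => E; under eq_bigr => k _ do rewrite mxE.
  by rewrite E; case: (v 0 j).
have Aq : A *m q = a *: q + b *: p.
  rewrite -symA -trmx_mul; apply/colP => j; rewrite !mxE.
  have /rowP/(_ j)/(congr1 (@complex.Im R)) := vA.
  rewrite !mxE; under eq_bigr => k _ do rewrite mxE.
  rewrite ImM => E; under eq_bigr => k _ do rewrite mxE.
  by rewrite E; case: (v 0 j).
have pq0 : (p != 0) || (q != 0).
  apply/orP; case: (eqVneq p 0) => [p0|]; last by left.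
  right; apply: contra_neq v0 => q0; apply/rowP => j; rewrite mxE.
  have /colP/(_ j) := p0; have /colP/(_ j) := q0; rewrite !mxE.
  by case: (v 0 j) => x y /= -> ->.
have b0 : b = 0.
  have : mxdot (A *m p) q = mxdot p (A *m q) by rewrite mxdot_mull symA.
  rewrite Ap Aq !mxdotl => E.
  have : b * (mxdot p p + mxdot q q) == 0 by apply/eqP; move: E; lra.
  rewrite mulf_eq0 => /orP[/eqP//|].
  by rewrite paddr_eq0 ?mxdot_ge0// !mxdot_eq0; case/orP: pq0 => /negPf->; rewrite ?andbF.
exists a; case/orP: pq0 => pq0; [exists p | exists q]; split=> //.
  by rewrite Ap b0 scale0r subr0.
by rewrite Aq b0 scale0r addr0.
Qed.

Lemma mulmx_colrow n (u v w : 'cV[R]_n) : u *m v^T *m w = mxdot v w *: u.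
Proof.
rewrite -mulmxA [v^T *m w]mx11_scalar mul_mx_scalar; congr (_ *: _).
by rewrite /mxdot /mxtrace big_ord1.
Qed.

(* The Householder reflection along u - v. *)
Lemma reflection_swap n (u v : 'cV[R]_n) : mxdot u u = mxdot v v ->
  exists H : 'M[R]_n, [/\ H^T = H, H *m H = 1%:M & H *m u = v].
Proof.
move=> uv; case: (eqVneq u v) => [->|neq_uv].
  by exists 1%:M; rewrite trmx1 !mul1mx.
pose x := u - v; pose c := 2 / mxdot x x.
have x0 : mxdot x x != 0 by rewrite mxdot_eq0 subr_eq0.
exists (1%:M - c *: (x *m x^T)); split.
- by rewrite linearB /= trmx1 linearZ /= trmx_mul trmxK.
- rewrite mulmxBl mul1mx mulmxBr mulmx1 -!scalemxAl -!scalemxAr mulmxA.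
  rewrite mulmx_colrow -scalemxAl.
  apply/matrixP => i j; rewrite !mxE /c; field; exact: x0.
rewrite mulmxBl mul1mx -scalemxAl mulmx_colrow scalerA.
suff -> : c * mxdot x u = 1 by rewrite scale1r /x opprB addrC subrK.
suff E : 2 * mxdot x u = mxdot x x by rewrite /c mulrAC E divff.
by rewrite /x !mxdotl -uv (mxdotC v u); ring.
Qed.

(** Deflation by induction on the size: a Householder reflection carries a unit eigenvector to the
    first basis vector, and symmetry then splits off a block of size one. The entries of [D] come in
    no particular order. *)
Theorem symmetric_spectral n (A : 'M[R]_n) : A^T = A ->
  exists (P : 'M[R]_n) (D : 'rV[R]_n),
    P^T *m P = 1%:M /\ A = P^T *m diag_mx D *m P.
Proof.
elim: n A => [|n IHn] A symA.
  by exists 1%:M, 0; split; apply/matrixP => -[].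
move: A symA; rewrite -[n.+1]/(1 + n)%N => A symA.
have [a [u [u0 Au]]] : exists a (u : 'cV[R]_(1 + n)), u != 0 /\ A *m u = a *: u.
  exact: symmetric_eigenvector symA.
pose e1 : 'cV[R]_(1 + n) := delta_mx 0 0.
have e11 : mxdot e1 e1 = 1.
  rewrite mxdotE (bigD1 0)//= big_ord1 !mxE mulr1 big1 ?addr0// => i /negPf i0.
  by rewrite big_ord1 !mxE i0 mul0r.
pose s := Num.sqrt (mxdot u u).
have s0 : s != 0 by rewrite sqrtr_eq0 -ltNge mxdot_gt0.
have [|H [symH HH Hu]] := @reflection_swap _ (s^-1 *: u) e1.
  rewrite !mxdotl e11 mulrA -invfM -expr2 sqr_sqrtr ?mxdot_ge0// mulVf//.
  by rewrite mxdot_eq0.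
have He1 : H *m e1 = s^-1 *: u by rewrite -Hu mulmxA HH mul1mx.
have [B defB] : exists B : 'M[R]_(1 + n), B = H *m A *m H by exists (H *m A *m H).
have symB : B^T = B by rewrite defB !trmx_mul symH symA mulmxA.
have Be1 : B *m e1 = a *: e1.
  rewrite defB -mulmxA He1 -mulmxA -scalemxAr Au scalerA mulrC -scalerA -He1.
  by rewrite -scalemxAr mulmxA HH mul1mx.
have B_e1 i : B i 0 = a * (i == 0)%:R.
  by have := Be1; rewrite -colE => /colP/(_ i); rewrite !mxE andbT.
have BE : B = block_mx a%:M 0 0 (drsubmx B).
  rewrite -[LHS]submxK; congr block_mx; apply/matrixP => i j.
  - rewrite !mxE !ord1 -[RHS]mulr1 -[1 in RHS]/((0 == 0 :> 'I_n.+1)%:R) -B_e1.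
    by congr (B _ _); apply/val_inj.
  - have /matrixP/(_ (rshift 1 j) (lshift n i)) := symB; rewrite !mxE => ->.
    rewrite !ord1 (_ : lshift n 0 = 0) ?B_e1 ?mulr0//; exact/val_inj.
  - rewrite !mxE !ord1 (_ : lshift n 0 = 0) ?B_e1 ?mulr0//; exact/val_inj.
have [|P' [D' [P'P' BD']]] := IHn (drsubmx B).
  by rewrite trmx_drsub symB.
exists (block_mx 1%:M 0 0 P' *m H : 'M_(1 + n)), (row_mx a%:M D'); split.
  rewrite trmx_mul symH mulmxA -[H *m _ *m _]mulmxA tr_block_mx mulmx_block.
  rewrite !trmx0 trmx1 !mulmx0 !mul0mx P'P' mul1mx !addr0 add0r.
  by rewrite -scalar_mx_block mulmx1.
rewrite trmx_mul symH -!mulmxA -[LHS]mul1mx -HH -[LHS]mulmx1 -HH.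
rewrite -[H *m H *m A]mulmxA -!mulmxA; congr (H *m _); rewrite !mulmxA; congr (_ *m H).
rewrite -defB BE BD' diag_mx_row tr_block_mx !mulmx_block.
rewrite !(trmx0, trmx1, mulmx0, mul0mx, mul1mx, mulmx1, addr0, add0r).
by congr block_mx; apply/matrixP => i j; rewrite !ord1 !mxE.
Qed.

End RealMatrices.

(** * Quadratic forms, square roots and polar factors *)

Section SpectralConsequences.
Context {R : rcfType}.
Implicit Types m n p : nat.

(** Ties the diagonal entries to [spectrum], which is defined through the characteristic polynomial.
    [P] stays orthogonal over the polynomial ring, so the determinants of its two copies cancel. *)
Lemma char_poly_diag_conj n (P : 'M[R]_n) (D : 'rV[R]_n) : P^T *m P = 1%:M ->
  char_poly (P^T *m diag_mx D *m P) = \prod_k ('X - (D 0 k)%:P).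
Proof.
move=> PP; pose pP := map_mx polyC P.
have pPP : pP^T *m pP = 1%:M by rewrite /pP map_trmx -map_mxM PP map_mx1.
have -> : char_poly (P^T *m diag_mx D *m P) = char_poly (diag_mx D).
  rewrite /char_poly (_ : char_poly_mx _ = pP^T *m char_poly_mx (diag_mx D) *m pP).
    by rewrite !det_mulmx mulrAC -det_mulmx pPP det1 mul1r.
  rewrite /char_poly_mx mulmxBr mulmxBl !map_mxM -map_trmx; congr (_ - _).
  by rewrite mul_mx_scalar -scalemxAl pPP scalemx1.
rewrite char_poly_trig; last first.
  by apply/is_trig_mxP => i j ij; rewrite mxE -val_eqE (ltn_eqF ij) mulr0n.
by apply: eq_bigr => k _; rewrite mxE eqxx.
Qed.

Lemma mxdot_diag_conj n (P : 'M[R]_n) (D : 'rV[R]_n) (u : 'cV[R]_n) :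
  mxdot u (P^T *m diag_mx D *m P *m u) =
  \sum_k D 0 k * (P *m u) k 0 ^+ 2.
Proof.
rewrite -!mulmxA -mxdot_mull mxdotE; apply: eq_bigr => k _.
by rewrite big_ord1 mul_diag_mx !mxE; ring.
Qed.

Lemma mxdot_isometry m n p (P : 'M[R]_(m, n)) (A B : 'M[R]_(n, p)) :
  P^T *m P = 1%:M -> mxdot (P *m A) (P *m B) = mxdot A B.
Proof. by move=> PP; rewrite mxdot_mull mulmxA PP mul1mx. Qed.

Lemma mxdot_cV n (u : 'cV[R]_n) : mxdot u u = \sum_k u k 0 ^+ 2.
Proof. by rewrite mxdotE; apply: eq_bigr => k _; rewrite big_ord1 expr2. Qed.

Lemma mxdot_cols m p (A B : 'M[R]_(m, p)) :
  mxdot A B = \sum_j mxdot (col j A) (col j B).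
Proof.
rewrite mxdotE exchange_big; apply: eq_bigr => j _; rewrite mxdotE.
by apply: eq_bigr => i _; rewrite big_ord1 !mxE.
Qed.

(** For symmetric [S] this bounds the eigenvalues from below; for [S = X^T *m X] and [c >= 0] it
    says that the singular values of [X] are at least the square root of [c]. *)
Definition bounded_below n (c : R) (S : 'M[R]_n) :=
  forall u : 'cV[R]_n, c * mxdot u u <= mxdot u (S *m u).

Lemma bounded_below_mx n p c (S : 'M[R]_n) (B : 'M[R]_(n, p)) :
  bounded_below c S -> c * mxdot B B <= mxdot B (S *m B).
Proof.
move=> Sc; rewrite !mxdot_cols mulr_sumr; apply: ler_sum => j _.
by rewrite !colE -mulmxA.
Qed.

(** The bound is applied to a matrix whose columns span the kernel of [S]: its norm has to
    vanish. *)
Lemma bounded_below_unitmx n c (S : 'M[R]_n) : 0 < c -> bounded_below c S ->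
  S \in unitmx.
Proof.
move=> c0 Sc; rewrite -unitmx_tr -row_free_unit -kermx_eq0.
set K := kermx _; have KS : S *m K^T = 0.
  by rewrite -[S]trmxK -trmx_mul mulmx_ker trmx0.
have := bounded_below_mx K^T Sc; rewrite KS {2}/mxdot mulmx0 mxtrace0.
rewrite pmulr_rle0// le_eqVlt ltNge mxdot_ge0 orbF mxdot_eq0 => /eqP K0.
by rewrite -[K]trmxK K0 trmx0.
Qed.

Lemma symmetric_sqrt n c (M : 'M[R]_n) :
  0 <= c -> M^T = M -> bounded_below (c ^+ 2) M ->
  exists S : 'M[R]_n, [/\ S^T = S, S *m S = M & bounded_below c S].
Proof.
move=> c0 symM Mc; have [P [D [PP defM]]] := symmetric_spectral symM.
have PPt : P *m P^T = 1%:M by apply: mulmx1C.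
have Dc k : c ^+ 2 <= D 0 k.
  (* Testing the bound on the [k]-th eigenvector isolates [D 0 k]. *)
  have := Mc (P^T *m delta_mx k 0).
  rewrite mxdot_isometry ?trmxK// defM mxdot_diag_conj mulmxA PPt mul1mx.
  rewrite mxdot_cV (bigD1 k)//= big1 => [|i /negPf ik]; last first.
    by rewrite mxE ik expr0n.
  rewrite (bigD1 k)//= big1 => [|i /negPf ik]; last first.
    by rewrite mxE ik expr0n mulr0.
  by rewrite !mxE !eqxx /= !addr0 !expr1n !mulr1.
have D0 k : 0 <= D 0 k by apply: le_trans (Dc k); apply: sqr_ge0.
exists (P^T *m diag_mx (map_mx Num.sqrt D) *m P); split.
- by rewrite !trmx_mul trmxK tr_diag_mx mulmxA.
- rewrite defM -!mulmxA [P *m _]mulmxA PPt mul1mx; congr (_ *m _).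
  rewrite !mulmxA mulmx_diag; congr (diag_mx _ *m _).
  by apply/rowP => k; rewrite !mxE -expr2 sqr_sqrtr.
move=> u; rewrite -(mxdot_isometry u u PP) mxdot_cV mxdot_diag_conj mulr_sumr.
apply: ler_sum => k _; rewrite [map_mx _ _ _ _]mxE ler_wpM2r ?sqr_ge0//.
by have := ler_wsqrtr (Dc k); rewrite sqrtr_sqr ger0_norm.
Qed.

(* With N = Q - P, expanding the trace shows that the left-hand side is
   <N, N S>. *)
Lemma polar_gap n c (Q P S : 'M[R]_n) :
  Q^T *m Q = 1%:M -> P^T *m P = 1%:M -> S^T = S -> bounded_below c S ->
  c * mxdot (Q - P) (Q - P) <= 2 * mxdot (Q - P) (Q *m S).
Proof.
move=> QQ PP symS Sc; set N := Q - P.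
have -> : 2 * mxdot N (Q *m S) = mxdot N (N *m S).
  have E : mxdot Q (P *m S) = mxdot P (Q *m S).
    rewrite /mxdot -mxtrace_tr !trmx_mul trmxK symS -mulmxA mxtrace_mulC.
    by rewrite mulmxA.
  have F : mxdot Q (Q *m S) = mxdot P (P *m S) by rewrite /mxdot !mulmxA QQ PP.
  by rewrite /N mulmxBl !mxdotl E F; ring.
(* Transposing puts [S] on the left, where its bound applies column by column. *)
have T (A B : 'M[R]_n) : mxdot A B = mxdot A^T B^T.
  by rewrite /mxdot trmxK -mxtrace_tr trmx_mul trmxK mxtrace_mulC.
rewrite T [in leRHS]T trmx_mul symS; exact: bounded_below_mx.
Qed.

(** Two instances of [polar_gap] with the roles exchanged add up to c |N|^2 <= <N, E>, where N is
    the difference of the orthogonal factors and E that of the products. Then |c N - E|^2 >= 0 takes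
    the place of Cauchy-Schwarz. *)
Lemma polar_factor_lipschitz n c (Q Q' S S' : 'M[R]_n) : 0 <= c ->
  Q^T *m Q = 1%:M -> Q'^T *m Q' = 1%:M -> S^T = S -> S'^T = S' ->
  bounded_below c S -> bounded_below c S' ->
  c ^+ 2 * mxdot (Q - Q') (Q - Q') <=
  mxdot (Q *m S - Q' *m S') (Q *m S - Q' *m S').
Proof.
move=> c0 QQ QQ' symS symS' Sc Sc'.
have G := polar_gap QQ QQ' symS Sc; have G' := polar_gap QQ' QQ symS' Sc'.
rewrite -[Q' - Q]opprB in G'; move: (Q - Q') => N in G G' *.
have {G G'} : c * mxdot N N <= mxdot N (Q *m S - Q' *m S').
  by move: G'; rewrite mxdotDr !(mxdotNl, mxdotNr); lra.
move: (Q *m S - _) => E /(ler_wpM2l c0).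
by have := mxdot_ge0 (c *: N - E); rewrite !mxdotl (mxdotC E N); nra.
Qed.

End SpectralConsequences.

(** * The nearest orthogonal matrix, and a Rayleigh bound for the second eigenvalue *)

Section Rounding.
Context {R : realType}.
Implicit Types m n p d : nat.

Lemma frobenius_normE m p (A : 'M[R]_(m, p)) :
  frobenius_norm A ^+ 2 = mxdot A A.
Proof.
have -> : mxdot A A = \sum_i \sum_j A i j ^+ 2.
  by rewrite mxdotE; do 2![apply: eq_bigr => ? _]; rewrite expr2.
by rewrite sqr_sqrtr//; do 2![apply: sumr_ge0 => ? _]; exact: sqr_ge0.
Qed.

Lemma frobenius_norm_le m p (A B : 'M[R]_(m, p)) :
  (frobenius_norm A <= frobenius_norm B) = (mxdot A A <= mxdot B B).
Proof. by rewrite -!frobenius_normE ler_sqr ?nnegrE ?sqrtr_ge0. Qed.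

(** Identifies the rounding with the orthogonal polar factor: [S] is the square root of [A^T *m A],
    and [A *m invmx S] turns out to be the only closest orthogonal matrix. *)
Lemma round_orthogonal_polar d c (A : 'M[R]_d) : 0 < c ->
  bounded_below (c ^+ 2) (A^T *m A) ->
  exists S : 'M[R]_d,
    [/\ S^T = S, bounded_below c S & A = round_orthogonal A *m S].
Proof.
move=> c0 Ac.
have [|S [symS SS Sc]] := symmetric_sqrt (ltW c0) _ Ac.
  by rewrite trmx_mul trmxK.
have uS := bounded_below_unitmx c0 Sc; exists S; split=> //.
pose Q := A *m invmx S; have defA : A = Q *m S by rewrite mulmxKV.
have QQ : Q^T *m Q = 1%:M.
  rewrite /Q trmx_mul trmx_inv symS !mulmxA -[_ *m A^T *m A]mulmxA -SS.
  by rewrite mulmxA mulVmx// mul1mx mulmxV.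
have uA : A \in unitmx.
  by rewrite defA unitmx_mul uS andbT; case/mulmx1_unit: QQ.
(* The extra term with factor [c] gives uniqueness of the minimizer along with minimality, so [xget]
   can only return [Q]. *)
have gap P : orthogonal_mx P ->
    mxdot (A - Q) (A - Q) + c * mxdot (Q - P) (Q - P) <= mxdot (A - P) (A - P).
  move=> PP; have := polar_gap QQ PP symS Sc; rewrite -defA.
  have QP : mxdot Q Q = mxdot P P by rewrite /mxdot QQ PP.
  move: (mxdot (Q - P) (Q - P)) => x.
  by rewrite !mxdotl (mxdotC Q A) (mxdotC P A) QP; lra.
rewrite /round_orthogonal uA (_ : xget _ _ = Q)//; apply: xget_unique.
  split=> // P /gap; rewrite frobenius_norm_le; apply: le_trans.
  by rewrite lerDl mulr_ge0 ?mxdot_ge0 1?ltW.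
move=> P [PP /(_ Q QQ)]; rewrite frobenius_norm_le => PQ.
have := le_trans (gap P PP) PQ; rewrite gerDl pmulr_rle0// => QP.
by apply/esym/eqP; rewrite -subr_eq0 -mxdot_eq0 eq_le QP mxdot_ge0.
Qed.

(* Since [eigval A 2 > 0], the kernel of A is spanned by psi, so the component
   of u orthogonal to psi only sees the eigenvalues from the second on. *)
Lemma rayleigh_second_eigenvalue n (A : 'M[R]_n) (psi u : 'cV[R]_n) :
  A^T = A -> bounded_below 0 A -> A *m psi = 0 -> psi != 0 ->
  0 < eigval A 2 ->
  eigval A 2 * (mxdot u u - mxdot u psi ^+ 2 / mxdot psi psi) <=
  mxdot u (A *m u).
Proof.
move=> symA A0 Apsi psi0 lam0.
have [P [D [PP defA]]] := symmetric_spectral symA.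
have PPt : P *m P^T = 1%:M by apply: mulmx1C.
have diagA (v : 'cV[R]_n) k : (P *m (A *m v)) k 0 = D 0 k * (P *m v) k 0.
  by rewrite defA !mulmxA PPt mul1mx -mulmxA mul_diag_mx mxE.
have D0 k : 0 <= D 0 k.
  have := A0 (P^T *m delta_mx k 0); rewrite mul0r defA mxdot_diag_conj.
  rewrite mulmxA PPt mul1mx (bigD1 k)//= big1 => [|i /negPf ik]; last first.
    by rewrite mxE ik expr0n mulr0.
  by rewrite !mxE !eqxx /= addr0 expr1n mulr1.
(* The default [[::]] of [xget] would make the second eigenvalue 0, which [lam0] excludes. *)
have [s_sorted] : sorted <=%R (spectrum A) /\
    char_poly A = \prod_(a <- spectrum A) ('X - a%:P).
  move: lam0; rewrite /eigval /spectrum; case: xgetP => [s -> //|_].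
  by rewrite ltxx.
rewrite {1}defA char_poly_diag_conj// -(big_map (D 0) xpredT (fun x => 'X - x%:P)).
move=> /prod_XsubC_eq perm_s; move: s_sorted lam0; rewrite /eigval.
move: (spectrum A) perm_s => s perm_s s_sorted lam0; set lam := s`_1 in lam0 *.
have [k0 /= k0psi] : exists k, (P *m psi) k 0 != 0.
  apply/existsP; apply: contraNT psi0 => /existsPn Ppsi.
  rewrite -[psi]mul1mx -PP -mulmxA (_ : P *m psi = 0) ?mulmx0//.
  by apply/colP => k; rewrite [RHS]mxE; apply/eqP; have := Ppsi k; rewrite negbK.
have Dk0 : D 0 k0 = 0.
  have /eqP := diagA psi k0; rewrite Apsi mulmx0 mxE eq_sym mulf_eq0.
  by rewrite (negPf k0psi) orbF => /eqP.
(* All eigenvalues are nonnegative and [D 0 k0] is 0, so it equals the head of the sorted list. With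
   one copy of it removed, the smallest remaining entry is [lam]. *)
have Dk k : k != k0 -> lam <= D 0 k.
  move=> kk0; have enumE := perm_to_rem (mem_index_enum k0).
  have {}perm_s : perm_eq (D 0 k0 :: [seq D 0 i | i <- rem k0 (index_enum 'I_n)]) s.
    by rewrite -(permPr perm_s) perm_sym (perm_map (D 0) enumE).
  have s_ge0 x : x \in s -> 0 <= x.
    by rewrite -(perm_mem perm_s) inE => /orP[/eqP->|/mapP[i _ ->]].
  rewrite /lam; case: s perm_s s_sorted s_ge0 {lam lam0} => [|a s] /=.
    by move=> /perm_nilP.
  rewrite (path_sortedE le_trans) => perm_s /andP[/allP a_min s_sorted] s_ge0.
  have a0 : a = D 0 k0.
    apply/le_anti; rewrite {2}Dk0 s_ge0 ?mem_head// andbT.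
    have := mem_head (D 0 k0) [seq D 0 i | i <- rem k0 (index_enum 'I_n)].
    by rewrite (perm_mem perm_s) inE => /orP[/eqP->|/a_min].
  move: perm_s; rewrite a0 perm_cons => perm_s.
  have : D 0 k \in s.
    rewrite -(perm_mem perm_s) map_f// mem_rem_uniq ?index_enum_uniq// inE kk0.
    exact: mem_index_enum.
  case: s s_sorted {s_ge0 a_min perm_s} => //= b s.
  rewrite (path_sortedE le_trans) inE => /andP[/allP b_min _].
  by case/orP => [/eqP->|/b_min].
(* Away from [k0] the eigenvalues are positive, so the kernel vector [psi] has only its [k0]
   coordinate in the eigenbasis. *)
have Ppsi0 k : k != k0 -> (P *m psi) k 0 = 0.
  move=> /Dk Dk_lam; have /eqP := diagA psi k; rewrite Apsi mulmx0 mxE eq_sym mulf_eq0.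
  by case/orP => /eqP // E; move: lam0; rewrite ltNge -E Dk_lam.
rewrite [in leRHS]defA mxdot_diag_conj.
rewrite -(mxdot_isometry u u PP) -(mxdot_isometry u psi PP) -(mxdot_isometry psi psi PP).
have dotk0 (v : 'cV[R]_n) : mxdot (P *m v) (P *m psi) = (P *m v) k0 0 * (P *m psi) k0 0.
  rewrite mxdotE (bigD1 k0)//= big_ord1 big1 ?addr0// => k /Ppsi0 E.
  by rewrite big_ord1 E mulr0.
rewrite !dotk0 (_ : _ / _ = (P *m u) k0 0 ^+ 2); last by field.
rewrite mxdot_cV (bigD1 k0)//= [_ + \sum_(_ | _) _]addrC addrK.
rewrite [leRHS](bigD1 k0)//= Dk0 mul0r add0r.
rewrite mulr_sumr; apply: ler_sum => k /Dk Dk_lam.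
by rewrite ler_wpM2r ?sqr_ge0.
Qed.

End Rounding.

(** * Frobenius norm inequalities and near-isometries *)

Section Norms.
Context {R : realType}.
Implicit Types m n p d : nat.

Lemma frobenius_norm_ge0 m p (A : 'M[R]_(m, p)) : 0 <= frobenius_norm A.
Proof. exact: sqrtr_ge0. Qed.

(** Cauchy-Schwarz, from |b A - a B|^2 >= 0 with a and b the norms; dividing by 2ab requires the
    zero cases apart. *)
Lemma mxdot_le_norm m p (A B : 'M[R]_(m, p)) :
  mxdot A B <= frobenius_norm A * frobenius_norm B.
Proof.
set a := frobenius_norm A; set b := frobenius_norm B.
have [a0 b0] : 0 <= a /\ 0 <= b by rewrite !frobenius_norm_ge0.
have AA : mxdot A A = a ^+ 2 by rewrite frobenius_normE.
have BB : mxdot B B = b ^+ 2 by rewrite frobenius_normE.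
case: (eqVneq A 0) => [A0|An0].
  by rewrite A0 /mxdot trmx0 mul0mx mxtrace0 mulr_ge0.
case: (eqVneq B 0) => [B0|Bn0].
  by rewrite B0 /mxdot mulmx0 mxtrace0 mulr_ge0.
have {}a0 : 0 < a by rewrite lt_neqAle a0 andbT eq_sym -sqrf_eq0 -AA mxdot_eq0.
have {}b0 : 0 < b by rewrite lt_neqAle b0 andbT eq_sym -sqrf_eq0 -BB mxdot_eq0.
have ab0 : 0 < 2 * (a * b) by rewrite !mulr_gt0.
have := mxdot_ge0 (b *: A - a *: B); rewrite !mxdotl AA BB (mxdotC B A) => H.
rewrite -(ler_pM2l ab0); lra.
Qed.

Lemma frobenius_norm_rev_triangle m p (A B : 'M[R]_(m, p)) :
  (frobenius_norm A - frobenius_norm B) ^+ 2 <= mxdot (A - B) (A - B).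
Proof.
have := mxdot_le_norm A B; rewrite !mxdotl (mxdotC B A) sqrrB !frobenius_normE.
lra.
Qed.

Lemma mxdot_delta n (j : 'I_n) (v : 'cV[R]_n) : mxdot (delta_mx j 0) v = v j 0.
Proof.
rewrite mxdotE (bigD1 j)//= big_ord1 mxE !eqxx mul1r big1 ?addr0// => i /negPf ij.
by rewrite big_ord1 mxE ij mul0r.
Qed.

(** By the parallelogram law |P - Q|^2 + |P + Q|^2 = 4d. *)
Lemma mxdot_orthogonal_subr d (P Q : 'M[R]_d) :
  orthogonal_mx P -> orthogonal_mx Q -> mxdot (P - Q) (P - Q) <= 4 * d%:R.
Proof.
move=> PP QQ; have := mxdot_ge0 (P + Q); rewrite !mxdotl (mxdotC Q P).
rewrite [mxdot P P]/mxdot [mxdot Q Q]/mxdot PP QQ mxtrace1; lra.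
Qed.

Definition isometry_defect d (Y : 'M[R]_d) (u : 'cV[R]_d) :=
  (frobenius_norm (Y *m u) - frobenius_norm u) ^+ 2.

(* By polarization the sums e_j + e_k and differences e_j - e_k recover the
   entries of Y^T Y - 1, which are then at most 3 / (4 d) in absolute value. *)
Lemma isometry_defect_bounded_below d (Y : 'M[R]_d) :
  (forall j k, isometry_defect Y (delta_mx j 0 + delta_mx k 0) +
     isometry_defect Y (delta_mx j 0 - delta_mx k 0) <= (9 * d%:R ^+ 2)^-1) ->
  bounded_below 4^-1 (Y^T *m Y).
Proof.
case: d Y => [|d] Y defect.
  by move=> u; rewrite (flatmx0 u) /mxdot mulmx0 !mulmx0 !mxtrace0 mulr0.
(* [dl ^+ 2] is the assumed bound on the defects, so [Y] changes each of the lengths concerned by at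
   most [dl <= 1/3]. *)
pose dl : R := (3 * d.+1%:R)^-1.
have d1 : 1 <= d.+1%:R :> R by rewrite ler1n.
have dl0 : 0 < dl by rewrite invr_gt0 mulr_gt0// ltr0n.
have dl3 : dl <= 3^-1 by rewrite lef_pV2 ?posrE ?mulr_gt0 ?ltr0n//; lra.
have dlE : (9 * d.+1%:R ^+ 2)^-1 = dl ^+ 2.
  by rewrite /dl exprVn; congr (_^-1); ring.
have unit2 j k (s : R) : s ^+ 2 = 1 ->
    mxdot (delta_mx j 0 + s *: delta_mx k 0)
      (delta_mx j 0 + s *: delta_mx k 0 : 'cV[R]_d.+1) <= 4.
  move=> s1.
  have dd (i : 'I_d.+1) : mxdot (delta_mx i 0) (delta_mx i 0 : 'cV[R]_d.+1) = 1.
    by rewrite mxdot_delta mxE !eqxx.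
  set a := delta_mx j 0; set b := delta_mx k 0.
  have := mxdot_ge0 (a - s *: b); rewrite !mxdotl /a /b !dd.
  by rewrite (mxdotC (delta_mx k 0)); nra.
(* The difference of squares factors; since |u| <= 2 and |Y u| <= 2 + 1/3, the sum of the two
   lengths is below 9/2. *)
have sqdiff (u : 'cV[R]_d.+1) : mxdot u u <= 4 -> isometry_defect Y u <= dl ^+ 2 ->
    `|mxdot (Y *m u) (Y *m u) - mxdot u u| <= 9 / 2 * dl.
  rewrite -!frobenius_normE /isometry_defect.
  move: (frobenius_norm (Y *m u)) (frobenius_norm_ge0 (Y *m u)) => a a0.
  move: (frobenius_norm u) (frobenius_norm_ge0 u) => b b0.
  rewrite (_ : 4 = 2 ^+ 2 :> R); last by ring.
  rewrite ler_sqr ?nnegrE// => b2.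
  rewrite -[(a - b) ^+ 2]real_normK ?num_real// ler_sqr ?nnegrE ?(ltW dl0)// => ab.
  rewrite subr_sqr normrM [`|a + b|]ger0_norm ?addr_ge0// mulrC.
  rewrite ler_pM ?addr_ge0//.
  by move: ab; rewrite ler_norml; lra.
have entry j k : `|(Y^T *m Y - 1%:M) j k| <= 9 / 4 * dl.
  set a := delta_mx j 0 : 'cV[R]_d.+1; set b := delta_mx k 0 : 'cV[R]_d.+1.
  have -> : (Y^T *m Y - 1%:M) j k = mxdot (Y *m a) (Y *m b) - mxdot a b.
    rewrite mxdot_mull mulmxA -{2}[b]mul1mx -mxdotNr -mxdotDr -mulmxBl.
    by rewrite -colE mxdot_delta [RHS]mxE.
  have dp : 0 <= isometry_defect Y (a + b) by apply: sqr_ge0.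
  have dm : 0 <= isometry_defect Y (a - b) by apply: sqr_ge0.
  have := defect j k; rewrite dlE -/a -/b => djk.
  have up : mxdot (a + b) (a + b) <= 4.
    by have := @unit2 j k 1 (expr1n _ _); rewrite scale1r.
  have um : mxdot (a - b) (a - b) <= 4.
    by have := @unit2 j k (-1) (etrans (sqrrN 1) (expr1n _ _)); rewrite scaleN1r.
  have /(sqdiff _ up) : isometry_defect Y (a + b) <= dl ^+ 2.
    by apply: le_trans djk; rewrite lerDl.
  have /(sqdiff _ um) : isometry_defect Y (a - b) <= dl ^+ 2.
    by apply: le_trans djk; rewrite lerDr.
  rewrite !mulmxDr !mulmxN !mxdotl (mxdotC b a) (mxdotC (Y *m b)).
  by rewrite !ler_norml; lra.
move=> u; rewrite -[Y^T *m Y](subrK 1%:M) mulmxDl mul1mx mxdotDr.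
move: (_ - 1%:M) entry => G entry.
suff : `|mxdot u (G *m u)| <= 3 / 4 * mxdot u u by rewrite ler_norml; lra.
have -> : mxdot u (G *m u) = \sum_j \sum_k u j 0 * G j k * u k 0.
  rewrite mxdotE; apply: eq_bigr => j _; rewrite big_ord1 mxE mulr_sumr.
  by apply: eq_bigr => k _; rewrite mulrA.
apply: le_trans (ler_norm_sum _ _ _) _.
(* Each term is split by xy <= (x^2 + y^2) / 2. Summation gives a factor 2 times the dimension, and
   9/8 times this times [dl] is 3/4. *)
apply: (@le_trans _ _ (\sum_j \sum_k (9 / 8 * dl * (u j 0 ^+ 2 + u k 0 ^+ 2)))).
  apply: ler_sum => j _; apply: le_trans (ler_norm_sum _ _ _) _.
  apply: ler_sum => k _; rewrite !normrM.
  have := entry j k; rewrite -[u j 0 ^+ 2]real_normK ?num_real//.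
  rewrite -[u k 0 ^+ 2]real_normK ?num_real//.
  move: `|u j 0| `|u k 0| (normr_ge0 (u j 0)) (normr_ge0 (u k 0)) => x y x0 y0.
  move: `|G j k| => g gd; apply: (@le_trans _ _ (9 / 4 * dl * (x * y))).
    by rewrite mulrAC mulrC ler_wpM2r// mulr_ge0.
  have := mulr_ge0 (ltW dl0) (sqr_ge0 (x - y)); rewrite sqrrB; lra.
have -> : \sum_j \sum_k (9 / 8 * dl * (u j 0 ^+ 2 + u k 0 ^+ 2)) =
   9 / 8 * dl * (2 * d.+1%:R * mxdot u u).
  under eq_bigr => j _ do rewrite -mulr_sumr big_split /= sumr_const card_ord -mxdot_cV.
  rewrite -mulr_sumr big_split /= sumr_const card_ord sumrMnl -mxdot_cV.
  by rewrite -mulrnDl -[in LHS]mulr_natl; ring.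
rewrite le_eqVlt; apply/orP; left; apply/eqP; rewrite /dl.
by move: (d.+1%:R) d1 => D D1; field; rewrite gt_eqF//; lra.
Qed.

End Norms.

(** * The Poincare inequality on the graph *)

Section Graph.
Context {R : realType} {n : nat} (w : 'M[R]_n).
Hypothesis w_sym : forall i j, w i j = w j i.
Hypothesis w_ge0 : forall i j, 0 <= w i j.
Hypothesis degree_gt0 : forall i, 0 < degree w i.

Lemma sum_edges_sym (a : 'I_n -> R) :
  \sum_i \sum_j w i j * (a i + a j) = 2 * \sum_i degree w i * a i.
Proof.
under eq_bigr => i _ do under eq_bigr => j _ do rewrite mulrDr.
under eq_bigr => i _ do rewrite big_split /= -mulr_suml -/(degree w i).
rewrite big_split /= [X in _ + X]exchange_big /=.
rewrite [X in _ + X](eq_bigr (fun i => degree w i * a i)) => [|j _]; first by ring.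
by rewrite -mulr_suml; congr (_ * _); apply: eq_bigr => i _; rewrite w_sym.
Qed.

(** Serves both Laplacians: with a_i = |x_i|^2 and b_ij = <x_i, rho_ij x_j> the summand on an edge
    is the weighted squared difference across it, and the right-hand side is what the Laplacian
    yields row by row. *)
Lemma sum_edges_polar (a : 'I_n -> R) (b : 'I_n -> 'I_n -> R) :
  2^-1 * (\sum_i \sum_j w i j * (a i + a j - 2 * b i j)) =
  \sum_i (degree w i * a i - \sum_j w i j * b i j).
Proof.
rewrite big_split /= sumrN.
have -> : \sum_i \sum_j w i j * (a i + a j - 2 * b i j) =
    2 * (\sum_i degree w i * a i) - 2 * \sum_i \sum_j w i j * b i j.
  rewrite -sum_edges_sym [2 * _]mulr_sumr -sumrB; apply: eq_bigr => i _.
  by rewrite mulr_sumr -sumrB; apply: eq_bigr => j _; ring.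
by field.
Qed.

Lemma volume_gt0 : (0 < n)%N -> 0 < volume w.
Proof.
case: n w degree_gt0 => // m w' w'_gt0 _.
rewrite /volume (bigD1 ord0)//= ltr_wpDr//.
by apply: sumr_ge0 => i _; apply: ltW.
Qed.

Lemma sqrt_degree_gt0 i : 0 < Num.sqrt (degree w i).
Proof. by rewrite sqrtr_gt0. Qed.

Lemma graph_laplacianE (u : 'cV[R]_n) i :
  (graph_laplacian w *m u) i 0 = u i 0 - (Num.sqrt (degree w i))^-1 *
    \sum_j w i j * ((Num.sqrt (degree w j))^-1 * u j 0).
Proof.
rewrite /graph_laplacian mulmxBl mul1mx -!mulmxA !mul_diag_mx !mxE; congr (_ - _ * _).
by apply: eq_bigr => j _; rewrite !mxE.
Qed.

Lemma graph_laplacian_form (f : 'I_n -> R) :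
  let u := \col_i (Num.sqrt (degree w i) * f i) in
  mxdot u (graph_laplacian w *m u) =
  2^-1 * \sum_i \sum_j w i j * (f i - f j) ^+ 2.
Proof.
move=> u.
transitivity (2^-1 * \sum_i \sum_j w i j * (f i ^+ 2 + f j ^+ 2 - 2 * (f i * f j))).
  rewrite (sum_edges_polar (fun i => f i ^+ 2) (fun i j => f i * f j)).
  rewrite mxdotE; apply: eq_bigr => i _; rewrite big_ord1 graph_laplacianE.
  under eq_bigr => j _ do rewrite mxE mulKf ?gt_eqF ?sqrt_degree_gt0//.
  under [in RHS]eq_bigr => j _ do rewrite mulrCA.
  rewrite -[in RHS]mulr_sumr mxE mulrBr -[in RHS](sqr_sqrtr (ltW (degree_gt0 i))).
  move: (\sum_(_ < _) _) => s; field; by rewrite gt_eqF ?sqrt_degree_gt0.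
by congr (_ * _); apply: eq_bigr => i _; apply: eq_bigr => j _; ring.
Qed.

Hypothesis lam_gt0 : 0 < eigval (graph_laplacian w) 2.

(** The Rayleigh bound for D_0^{1/2} f, with D_0^{1/2} 1 as kernel vector. The parenthesis is the
    degree-weighted sum of squared deviations of [f] from its weighted mean. *)
Lemma poincare (f : 'I_n -> R) : 0 < volume w ->
  eigval (graph_laplacian w) 2 *
    (\sum_i degree w i * f i ^+ 2 - (\sum_i degree w i * f i) ^+ 2 / volume w) <=
  2^-1 * \sum_i \sum_j w i j * (f i - f j) ^+ 2.
Proof.
move=> vol0; pose u (h : 'I_n -> R) := \col_i (Num.sqrt (degree w i) * h i).
have dotu h k : mxdot (u h) (u k) = \sum_i degree w i * (h i * k i).
  rewrite mxdotE; apply: eq_bigr => i _; rewrite big_ord1 !mxE.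
  by rewrite -[in RHS](sqr_sqrtr (ltW (degree_gt0 i))); ring.
have sym : (graph_laplacian w)^T = graph_laplacian w.
  rewrite /graph_laplacian linearB /= trmx1 !trmx_mul tr_diag_mx mulmxA.
  by congr (_ - _ *m _ *m _); apply/matrixP => i j; rewrite mxE w_sym.
have psd : bounded_below 0 (graph_laplacian w).
  move=> v; rewrite mul0r.
  have -> : v = u (fun i => (Num.sqrt (degree w i))^-1 * v i 0).
    apply/colP => i; rewrite mxE mulVKf// gt_eqF ?sqrt_degree_gt0//.
  rewrite graph_laplacian_form mulr_ge0 ?invr_ge0//.
  by do 2![apply: sumr_ge0 => ? _]; rewrite mulr_ge0 ?sqr_ge0.
pose one := fun _ : 'I_n => 1 : R.
have one1 : mxdot (u one) (u one) = volume w.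
  by rewrite dotu; apply: eq_bigr => i _; rewrite !mulr1.
have ker1 : graph_laplacian w *m u one = 0.
  apply/colP => i; rewrite graph_laplacianE !mxE mulr1.
  under eq_bigr => j _ do rewrite mxE mulr1 mulVf ?mulr1 ?gt_eqF ?sqrt_degree_gt0//.
  rewrite -/(degree w i) -[X in _ * X](sqr_sqrtr (ltW (degree_gt0 i))).
  by rewrite expr2 mulKf ?subrr// gt_eqF ?sqrt_degree_gt0.
have one0 : u one != 0 by rewrite -mxdot_eq0 one1 gt_eqF.
have := rayleigh_second_eigenvalue (u f) sym psd ker1 one0 lam_gt0.
rewrite graph_laplacian_form one1 !dotu.
under eq_bigr => i _ do rewrite -expr2.
by under [X in X ^+ 2]eq_bigr => i _ do rewrite mulr1.
Qed.

Hypothesis w_irr : forall i, w i i = 0.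

(* The Poincare inequality for the indicator function of a vertex. *)
Lemma second_eigenvalue_le2 : (0 < n)%N -> eigval (graph_laplacian w) 2 <= 2.
Proof.
move=> n0; have i0 := Ordinal n0; have vol0 := volume_gt0 n0.
have := poincare (fun i => (i == i0)%:R) vol0.
have lam0 := lam_gt0; set lam := eigval _ _ in lam0 *; set d := degree w i0.
have -> : \sum_i degree w i * (i == i0)%:R ^+ 2 = d.
  rewrite (bigD1 i0)//= eqxx expr1n mulr1 big1 ?addr0// => i /negPf->.
  by rewrite expr0n mulr0.
have -> : \sum_i degree w i * (i == i0)%:R = d.
  by rewrite (bigD1 i0)//= eqxx mulr1 big1 ?addr0// => i /negPf->; rewrite mulr0.
(* For indicator values (a - b)^2 <= a + b. *)
have cut : 2^-1 * (\sum_i \sum_j w i j * ((i == i0)%:R - (j == i0)%:R) ^+ 2) <= d.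
  have dE : d = 2^-1 * (\sum_i \sum_j w i j * ((i == i0)%:R + (j == i0)%:R)).
    rewrite (sum_edges_sym (fun i => (i == i0)%:R)) (bigD1 i0)//= eqxx mulr1.
    by rewrite big1 ?addr0 ?mulKf ?pnatr_eq0// => i /negPf->; rewrite mulr0.
  rewrite dE ler_pM2l ?invr_gt0//; do 2![apply: ler_sum => ? _].
  by rewrite ler_wpM2l//; do 2![case: (_ == _)] => /=; lra.
(* Without loops, every unit of weight at [i0] is counted again in the degree of a neighbour. *)
have half : 2 * d <= volume w.
  rewrite /volume (bigD1 i0)//= -/d mulrDl mul1r lerD2l /d /degree.
  rewrite (bigD1 i0)//= w_irr add0r; apply: ler_sum => i ii0.
  by rewrite w_sym (bigD1 i0)//= lerDl sumr_ge0.
move=> /le_trans/(_ cut); have d0 : 0 < d by apply: degree_gt0.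
rewrite -(ler_pM2r vol0) -mulrA mulrBl divfK ?gt_eqF// => H.
have K : lam * (volume w - d) <= volume w.
  by rewrite -(ler_pM2l d0); lra.
rewrite -(ler_pM2r vol0); have := ler_wpM2l (ltW lam0) half; lra.
Qed.

End Graph.

(** * Rounding *)

Lemma frobenius_normZ (R : realType) m p (s : R) (A : 'M[R]_(m, p)) :
  0 <= s -> frobenius_norm (s *: A) = s * frobenius_norm A.
Proof.
move=> s0; apply/eqP; rewrite -(eqrXn2 (_ : (0 < 2)%N))//; last first.
- by rewrite mulr_ge0 ?frobenius_norm_ge0.
- exact: frobenius_norm_ge0.
by rewrite exprMn !frobenius_normE mxdotZl mxdotZr; apply/eqP; ring.
Qed.

Section Synchronization.
Context {R : realType} {n d : nat} (w : 'M[R]_n).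
Context (rho : 'I_n -> 'I_n -> 'M[R]_d) (X : 'I_n -> 'M[R]_d) (lam : R).
Hypothesis w_sym : forall i j, w i j = w j i.
Hypothesis w_ge0 : forall i j, 0 <= w i j.
Hypothesis degree_gt0 : forall i, 0 < degree w i.
Hypothesis rho_orthogonal : forall i j, w i j != 0 -> orthogonal_mx (rho i j).
Hypothesis X_normalized : \sum_i degree w i *: ((X i)^T *m X i) = 1%:M.
Hypothesis volume_gt0 : 0 < volume w.
Hypothesis lam_gt0 : 0 < lam.
Hypothesis lam_poincare : forall f : 'I_n -> R,
  lam * (\sum_i degree w i * f i ^+ 2 - (\sum_i degree w i * f i) ^+ 2 / volume w) <=
  2^-1 * \sum_i \sum_j w i j * (f i - f j) ^+ 2.

Definition edge_residual i j := X i - rho i j *m X j.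

(** For a column [u] this is the Dirichlet energy of the section X u; for [u = 1%:M] it is the sum
    of the d smallest eigenvalues, by [energy_trace]. *)
Definition energy p (u : 'M[R]_(d, p)) :=
  2^-1 * \sum_i \sum_j w i j * mxdot (edge_residual i j *m u) (edge_residual i j *m u).

Lemma energy_ge0 p (u : 'M[R]_(d, p)) : 0 <= energy u.
Proof.
rewrite mulr_ge0 ?invr_ge0//; do 2![apply: sumr_ge0 => ? _].
by rewrite mulr_ge0 ?mxdot_ge0.
Qed.

Lemma energy_parallelogram p (u v : 'M[R]_(d, p)) :
  energy (u + v) + energy (u - v) = 2 * energy u + 2 * energy v.
Proof.
rewrite /energy -mulrDr !(mulrCA 2) -mulrDr; congr (_ * _).
rewrite !mulr_sumr -!big_split /=; apply: eq_bigr => i _.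
rewrite !mulr_sumr -!big_split /=; apply: eq_bigr => j _.
by rewrite !mulmxDr mulmxN !mxdotl; ring.
Qed.

Lemma sum_energy_delta : \sum_j energy (delta_mx j 0 : 'cV[R]_d) = energy 1%:M.
Proof.
rewrite -mulr_sumr exchange_big; congr (_ * _); apply: eq_bigr => i _.
rewrite exchange_big; apply: eq_bigr => j _.
rewrite -mulr_sumr mulmx1 mxdot_cols; congr (_ * _).
by apply: eq_bigr => k _; rewrite !colE.
Qed.

Lemma sum_degree_mxdot p (u : 'M[R]_(d, p)) :
  \sum_i degree w i * mxdot (X i *m u) (X i *m u) = mxdot u u.
Proof.
transitivity (mxdot u ((\sum_i degree w i *: ((X i)^T *m X i)) *m u)).
  rewrite mulmx_suml [in RHS]/mxdot mulmx_sumr raddf_sum /=.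
  by apply: eq_bigr => i _; rewrite -/(mxdot u _) -scalemxAl mxdotZr -mulmxA mxdot_mull.
by rewrite X_normalized mul1mx.
Qed.

(* The Poincare inequality for the norms |X_i u|: they are nearly constant,
   with mean square |u|^2 / vol. *)
Lemma sum_isometry_defect (u : 'cV[R]_d) :
  lam * \sum_i degree w i * isometry_defect (Num.sqrt (volume w) *: X i) u <=
  2 * volume w * energy u.
Proof.
set s := Num.sqrt _; have s2 : s ^+ 2 = volume w by rewrite sqr_sqrtr ?ltW.
have s0 : 0 < s by rewrite sqrtr_gt0.
pose f i := frobenius_norm (X i *m u); set a := frobenius_norm u.
pose c := \sum_i degree w i * f i.
have a0 : 0 <= a by apply: frobenius_norm_ge0.
have c0 : 0 <= c.
  by apply: sumr_ge0 => i _; rewrite mulr_ge0 ?frobenius_norm_ge0// ltW.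
have f2 : \sum_i degree w i * f i ^+ 2 = a ^+ 2.
  rewrite /a frobenius_normE -sum_degree_mxdot; apply: eq_bigr => i _.
  by rewrite /f frobenius_normE.
have quad x y : \sum_i degree w i * (x * f i - y) ^+ 2 =
    x ^+ 2 * a ^+ 2 - 2 * x * y * c + volume w * y ^+ 2.
  rewrite -f2 /c /volume !mulr_sumr mulr_suml -sumrB -big_split /=.
  by apply: eq_bigr => i _; ring.
have -> : \sum_i degree w i * isometry_defect (s *: X i) u =
    \sum_i degree w i * (s * f i - a) ^+ 2.
  apply: eq_bigr => i _; rewrite /isometry_defect -scalemxAl.
  by rewrite frobenius_normZ// ltW.
(* Cauchy-Schwarz for the degree weights, obtained from [quad] at x = vol and y = c. *)
have c_le : c <= s * a.
  rewrite -ler_sqr ?nnegrE ?mulr_ge0 ?(ltW s0)// exprMn s2.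
  have : 0 <= \sum_i degree w i * (volume w * f i - c) ^+ 2.
    by apply: sumr_ge0 => i _; rewrite mulr_ge0 ?sqr_ge0 1?ltW.
  rewrite quad -(pmulr_rge0 _ volume_gt0) => H.
  by rewrite -subr_ge0 -(pmulr_rge0 _ volume_gt0) -(pmulr_rge0 _ volume_gt0); nra.
(* As rho_ij preserves lengths, the reverse triangle inequality bounds the change of the norms
   across an edge by that of the section. *)
have dirichlet : 2^-1 * (\sum_i \sum_j w i j * (f i - f j) ^+ 2) <= energy u.
  rewrite ler_pM2l ?invr_gt0//; apply: ler_sum => i _; apply: ler_sum => j _.
  case: (eqVneq (w i j) 0) => [->|wij]; first by rewrite !mul0r.
  rewrite ler_wpM2l// mulmxBl (_ : f j = frobenius_norm (rho i j *m X j *m u)).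
    exact: frobenius_norm_rev_triangle.
  apply/eqP; rewrite -(eqrXn2 (_ : (0 < 2)%N)) ?frobenius_norm_ge0//.
  by rewrite !frobenius_normE -mulmxA (mxdot_isometry _ _ (rho_orthogonal wij)).
have := le_trans (lam_poincare f) dirichlet; rewrite f2 -/c => H.
have {}H : lam * (2 * volume w * (a ^+ 2 - c ^+ 2 / volume w)) <= 2 * volume w * energy u.
  by rewrite mulrCA ler_pM2l// mulr_gt0.
apply: le_trans H; rewrite ler_pM2l// quad s2.
rewrite mulrBr -[2 * volume w * (_ / _)]mulrA [volume w * (_ / _)]mulrC divfK ?gt_eqF//.
(* What remains is c^2 <= s a c. *)
have := ler_wpM2r c0 c_le; nra.
Qed.

Definition ill_conditioned i :=
  ~~ `[< bounded_below (4 * volume w)^-1 ((X i)^T *m X i) >].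

(** A Markov-type bound: by contraposition of [isometry_defect_bounded_below], a bad vertex has a
    pair [j], [k] whose defect exceeds 1 / (9 d^2), and all other terms are nonnegative. *)
Lemma ill_conditioned_defect i :
  (ill_conditioned i)%:R <= 9 * d%:R ^+ 2 * \sum_j \sum_k
     (isometry_defect (Num.sqrt (volume w) *: X i) (delta_mx j 0 + delta_mx k 0) +
      isometry_defect (Num.sqrt (volume w) *: X i) (delta_mx j 0 - delta_mx k 0)).
Proof.
pose Y := Num.sqrt (volume w) *: X i.
pose df j k := isometry_defect Y (delta_mx j 0 + delta_mx k 0) +
  isometry_defect Y (delta_mx j 0 - delta_mx k 0).
suff : (ill_conditioned i)%:R <= 9 * d%:R ^+ 2 * \sum_j \sum_k df j k by [].
have df0 j k : 0 <= df j k by rewrite addr_ge0 ?sqr_ge0.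
have [] := pselect (exists j k, (9 * d%:R ^+ 2)^-1 < df j k).
  move=> [j [k djk]]; have d0 : 0 < 9 * d%:R ^+ 2 :> R.
    by rewrite mulr_gt0// exprn_gt0// ltr0n (leq_trans _ (ltn_ord j)).
  apply: (@le_trans _ _ 1); first by case: (ill_conditioned i).
  rewrite -ler_pdivrMl// mulr1 (bigD1 j)//= (bigD1 k)//= -addrA.
  rewrite (le_trans (ltW djk))// lerDl addr_ge0//.
    by apply: sumr_ge0.
  by do 2![apply: sumr_ge0 => ? _].
move=> df_small; rewrite (_ : ill_conditioned i = false).
  by rewrite !mulr_ge0 ?sqr_ge0//; do 2![apply: sumr_ge0 => ? _].
apply/negbTE; rewrite negbK; apply/asboolP.
have /isometry_defect_bounded_below Yb : forall j k, df j k <= (9 * d%:R ^+ 2)^-1.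
  by move=> j k; rewrite leNgt; apply/negP => djk; apply: df_small; exists j, k.
have YY : Y^T *m Y = volume w *: ((X i)^T *m X i).
  by rewrite /Y -scalemxAr linearZ /= -scalemxAl scalerA -expr2 sqr_sqrtr ?ltW.
move=> u; have := Yb u; rewrite YY -scalemxAl mxdotZr => H.
by rewrite invfM -mulrA mulrCA ler_pdivrMl.
Qed.

(** By [sum_isometry_defect] and the parallelogram law, each pair [j], [k] costs 4 vol (E_j + E_k),
    with E_j the energy of e_j. Summing over pairs gives 8 d vol times the total energy, and 9 d^2
    times this is the bound. *)
Lemma volume_ill_conditioned :
  lam * \sum_i degree w i * (ill_conditioned i)%:R <=
  72 * d%:R ^+ 3 * volume w * energy 1%:M.
Proof.
pose Y i := Num.sqrt (volume w) *: X i.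
have H : \sum_i degree w i * (ill_conditioned i)%:R <=
   9 * d%:R ^+ 2 * \sum_j \sum_k
     ((\sum_i degree w i * isometry_defect (Y i) (delta_mx j 0 + delta_mx k 0)) +
      (\sum_i degree w i * isometry_defect (Y i) (delta_mx j 0 - delta_mx k 0))).
  apply: (@le_trans _ _ (\sum_i degree w i * (9 * d%:R ^+ 2 * \sum_j \sum_k
     (isometry_defect (Y i) (delta_mx j 0 + delta_mx k 0) +
      isometry_defect (Y i) (delta_mx j 0 - delta_mx k 0))))).
    by apply: ler_sum => i _; rewrite ler_pM2l// ill_conditioned_defect.
  under eq_bigr => i _ do rewrite mulrCA.
  rewrite -mulr_sumr ler_wpM2l ?mulr_ge0 ?sqr_ge0//.
  under eq_bigr => i _ do rewrite mulr_sumr.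
  rewrite exchange_big /=; apply: ler_sum => j _.
  under eq_bigr => i _ do rewrite mulr_sumr.
  rewrite exchange_big /=; apply: ler_sum => k _.
  by rewrite -big_split /=; apply: ler_sum => i _; rewrite mulrDr.
apply: le_trans (ler_wpM2l (ltW lam_gt0) H) _.
rewrite mulrCA mulr_sumr.
apply: (@le_trans _ _ (9 * d%:R ^+ 2 * \sum_(j < d) \sum_(k < d) 4 * volume w *
    (energy (delta_mx j 0 : 'cV[R]_d) + energy (delta_mx k 0 : 'cV[R]_d)))).
  rewrite ler_wpM2l ?mulr_ge0 ?sqr_ge0//; apply: ler_sum => j _.
  rewrite mulr_sumr; apply: ler_sum => k _.
  rewrite mulrDr.
  apply: le_trans (lerD (sum_isometry_defect _) (sum_isometry_defect _)) _.
  by rewrite -mulrDr energy_parallelogram le_eqVlt; apply/orP; left; apply/eqP; ring.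
under eq_bigr => j _.
  rewrite -mulr_sumr big_split /= sumr_const card_ord sum_energy_delta; over.
rewrite -mulr_sumr big_split /= sumr_const card_ord sumrMnl sum_energy_delta.
by rewrite -[_ *+ d]mulr_natl le_eqVlt; apply/orP; left; apply/eqP; ring.
Qed.

Lemma edge_rounding_bound i j : w i j != 0 ->
  frobenius_norm (round_orthogonal (X i) - rho i j *m round_orthogonal (X j)) ^+ 2 <=
  4 * d%:R * ((ill_conditioned i)%:R + (ill_conditioned j)%:R) +
  4 * volume w * mxdot (edge_residual i j) (edge_residual i j).
Proof.
move=> /rho_orthogonal rhoO; rewrite frobenius_normE.
have gO k := round_orthogonalP (X k).
have rgO : orthogonal_mx (rho i j *m round_orthogonal (X j)).
  rewrite /orthogonal_mx trmx_mul mulmxA -[_ *m _ *m rho i j]mulmxA rhoO mulmx1.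
  exact: gO.
have [bad|] := boolP (ill_conditioned i || ill_conditioned j).
  apply: le_trans (mxdot_orthogonal_subr (gO i) rgO) _.
  rewrite -[leLHS]addr0 lerD ?mulr_ge0 ?mxdot_ge0 ?(ltW volume_gt0)//.
  rewrite ler_peMr ?mulr_ge0//.
  by case/orP: bad => ->; rewrite ?lerDl ?lerDr.
rewrite negb_or => /andP[goodi goodj].
rewrite (negPf goodi) (negPf goodj) addr0 mulr0 add0r.
pose c := (2 * Num.sqrt (volume w))^-1.
have c0 : 0 < c by rewrite invr_gt0 mulr_gt0// sqrtr_gt0.
have c2 : c ^+ 2 = (4 * volume w)^-1.
  by rewrite /c exprVn exprMn sqr_sqrtr ?ltW//; congr (_^-1); ring.
have good k : ~~ ill_conditioned k -> bounded_below (c ^+ 2) ((X k)^T *m X k).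
  by rewrite negbK c2 => /asboolP.
have [Si [symSi Sic defXi]] := round_orthogonal_polar c0 (good i goodi).
have [Sj [symSj Sjc defXj]] := round_orthogonal_polar c0 (good j goodj).
(* The matrix rho_ij X_j has the same symmetric factor [Sj] as X_j, so its polar factor is rho_ij
   times the rounding of X_j. The constant 4 vol is the inverse of [c ^+ 2]. *)
have := polar_factor_lipschitz (ltW c0) (gO i) rgO symSi symSj Sic Sjc.
by rewrite -mulmxA -defXi -defXj c2 mulrC ler_pdivrMr ?mulr_gt0// mulrC.
Qed.

Lemma rounding_bound : lam <= 2 -> (0 < d)%N ->
  frustration w rho (fun i => round_orthogonal (X i)) <=
  1026 * d%:R ^+ 3 * lam^-1 * energy 1%:M.
Proof.
move=> lam2 d0; have vol0 := volume_gt0; set V := volume w in vol0 *; set L := energy _.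
have d1 : 1 <= d%:R :> R by rewrite ler1n.
have L0 : 0 <= L by apply: energy_ge0.
pose B := \sum_i degree w i * (ill_conditioned i)%:R.
have total : \sum_i \sum_j w i j *
    frobenius_norm (round_orthogonal (X i) - rho i j *m round_orthogonal (X j)) ^+ 2 <=
    8 * d%:R * B + 8 * V * L.
  apply: (@le_trans _ _ (4 * d%:R *
      (\sum_i \sum_j w i j * ((ill_conditioned i)%:R + (ill_conditioned j)%:R)) +
      4 * V * \sum_i \sum_j w i j * mxdot (edge_residual i j) (edge_residual i j))).
    rewrite [4 * d%:R * _]mulr_sumr [4 * V * _]mulr_sumr -big_split.
    apply: ler_sum => i _ /=; rewrite [4 * d%:R * _]mulr_sumr [4 * V * _]mulr_sumr -big_split.
    apply: ler_sum => j _ /=.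
    case: (eqVneq (w i j) 0) => [->|wij]; first by rewrite !mul0r !mulr0 addr0.
    rewrite [_ * (w i j * _)]mulrCA [_ * (w i j * mxdot _ _)]mulrCA -mulrDr.
    by rewrite ler_wpM2l// edge_rounding_bound.
  rewrite (sum_edges_sym w_sym (fun i => (ill_conditioned i)%:R)) -/B /L /energy.
  under [in leRHS]eq_bigr => i _ do under eq_bigr => j _ do rewrite mulmx1.
  by rewrite le_eqVlt; apply/orP; left; apply/eqP; field.
have lamB : lam * B <= 72 * d%:R ^+ 3 * V * L by apply: volume_ill_conditioned.
rewrite /frustration -/V; set N := \sum_i _ in total *.
(* The bad edges give 8 * 72 = 576 and the good ones, using [lam <= 2], give 16; both fit amply
   under 2052 = 2 * 1026. *)
have key : lam * N <= 2052 * d%:R ^+ 4 * V * L.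
  have VL : 0 <= V * L by rewrite mulr_ge0// ltW.
  apply: le_trans (ler_wpM2l (ltW lam_gt0) total) _; rewrite mulrDr.
  have d4 : 1 <= d%:R ^+ 4 :> R by rewrite exprn_ege1.
  have H1 : lam * (8 * d%:R * B) <= 576 * d%:R ^+ 4 * (V * L).
    have := ler_wpM2l (_ : 0 <= 8 * d%:R) lamB; rewrite mulr_ge0 ?ler0n// => /(_ isT).
    rewrite mulrCA => /le_trans; apply.
    by rewrite le_eqVlt; apply/orP; left; apply/eqP; ring.
  have H2 : lam * (8 * V * L) <= 16 * d%:R ^+ 4 * (V * L).
    have := ler_pM (ltW lam_gt0) ler01 lam2 d4 => /(ler_wpM2r VL); lra.
  by have := ler_wpM2l VL d4; have := mulr_ge0 (le_trans ler01 d4) VL; lra.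
have -> : 1026 * d%:R ^+ 3 * lam^-1 * L =
    (2 * d%:R)^-1 * V^-1 * (lam^-1 * (2052 * d%:R ^+ 4 * V * L)).
  by field; rewrite !gt_eqF// (lt_le_trans ltr01 d1).
rewrite ler_wpM2l ?mulr_ge0 ?invr_ge0 ?mulr_ge0 ?(ltW vol0)//.
by rewrite -(mulKf (lt0r_neq0 lam_gt0) N) ler_pM2l ?invr_gt0.
Qed.

End Synchronization.

(** * From eigenvectors of the Connection Laplacian to vertex blocks *)

Section ConnectionLaplacian.
Context {R : realType} {n d : nat} (w : 'M[R]_n).
Context (rho : 'I_n -> 'I_n -> 'M[R]_d) (z : 'I_d -> 'cV[R]_(\sum_(i < n) d)).
Hypothesis w_sym : forall i j, w i j = w j i.
Hypothesis degree_gt0 : forall i, 0 < degree w i.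
Hypothesis rho_orthogonal : forall i j, w i j != 0 -> orthogonal_mx (rho i j).
Hypothesis z_orthonormal : forall j k, (z j)^T *m z k = (j == k)%:R%:M.

Let Z : 'M[R]_(\sum_(i < n) d, d) := \matrix_(s, j) z j s 0.
Let X i := block_matrix (fun j => D1_invsqrt d w *m z j) i.

Let col_Z j : col j Z = z j.
Proof. by apply/colP => s; rewrite !mxE. Qed.

Let Z_orthonormal : Z^T *m Z = 1%:M.
Proof.
apply/matrixP => j k; rewrite [RHS]mxE.
have /matrixP/(_ 0 0) := z_orthonormal j k; rewrite [RHS]mxE mulr1n => <-.
by rewrite !mxE; apply: eq_bigr => s _; rewrite !mxE.
Qed.

Let submxcol_Z i : submxcol Z i = Num.sqrt (degree w i) *: X i.
Proof.
have XE : X i = submxcol (D1_invsqrt d w *m Z) i.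
  by apply/matrixP => a j; rewrite !mxE; apply: eq_bigr => s _; rewrite !mxE.
rewrite XE -[Z in RHS]submxcolK /D1_invsqrt mul_mxdiag_mxcol mxcolK mul_scalar_mx.
by rewrite scalerA mulfV ?scale1r// gt_eqF// sqrtr_gt0.
Qed.

(** This is Z^T Z = 1 read block by block, since the i-th block of [Z] is X_i scaled by the square
    root of the degree. *)
Lemma block_matrix_normalized : \sum_i degree w i *: ((X i)^T *m X i) = 1%:M.
Proof.
rewrite -Z_orthonormal -[Z]submxcolK tr_mxcol mul_mxrow_mxcol.
apply: eq_bigr => i _; rewrite submxcol_Z -scalemxAr [(_ *: _)^T]linearZ /=.
by rewrite -scalemxAl scalerA -expr2 sqr_sqrtr// ltW.
Qed.

(** The trace of Z^T L_1 Z is computed twice: by columns it is the sum of the eigenvalues, by vertex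
    blocks it is the edge sum. *)
Lemma energy_trace (lam : 'I_d -> R) :
  (forall j, connection_laplacian w rho *m z j = lam j *: z j) ->
  \sum_j lam j = energy w rho X 1%:M.
Proof.
move=> eigz.
have -> : \sum_j lam j = mxdot Z (connection_laplacian w rho *m Z).
  rewrite mxdot_cols; apply: eq_bigr => j _.
  rewrite [col j (_ *m _)]colE -mulmxA -colE col_Z.
  rewrite eigz mxdotZr /mxdot z_orthonormal eqxx mxtrace_scalar.
  by rewrite mulr1.
have b_i i j : w i j * mxdot (edge_residual rho X i j) (edge_residual rho X i j) =
    w i j * (mxdot (X i) (X i) + mxdot (X j) (X j) - 2 * mxdot (X i) (rho i j *m X j)).
  case: (eqVneq (w i j) 0) => [->|wij]; first by rewrite !mul0r.
  rewrite /edge_residual !mxdotl (mxdot_isometry _ _ (rho_orthogonal wij)).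
  by rewrite (mxdotC (rho i j *m X j)); ring.
rewrite /energy.
under [in RHS]eq_bigr => i _ do under eq_bigr => j _ do rewrite mulmx1 b_i.
rewrite (sum_edges_polar w_sym (fun i => mxdot (X i) (X i))
  (fun i j => mxdot (X i) (rho i j *m X j))).
have LZ : connection_laplacian w rho *m Z = \mxcol_i (Num.sqrt (degree w i) *: X i -
    (Num.sqrt (degree w i))^-1 *: \sum_j w i j *: (rho i j *m X j)).
  rewrite /connection_laplacian mulmxBl mul1mx -!mulmxA -[Z]submxcolK.
  rewrite /D1_invsqrt mul_mxdiag_mxcol /W1 mul_mxblock_mxrow mul_mxdiag_mxcol -mxcolB.
  apply: eq_mxcol => i; rewrite mul_scalar_mx submxcol_Z; congr (_ - _ *: _).
  apply: eq_bigr => j _; rewrite mul_scalar_mx submxcol_Z scalerA mulVf ?scale1r.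
    by rewrite scalemxAl.
  by rewrite gt_eqF// sqrtr_gt0.
rewrite LZ /mxdot -[Z]submxcolK tr_mxcol mul_mxrow_mxcol raddf_sum.
apply: eq_bigr => i _ /=; rewrite -/(mxdot _ _) submxcol_Z.
rewrite mxdotDr mxdotNr !mxdotZl !mxdotZr mulrA -expr2 sqr_sqrtr ?ltW//.
rewrite mulrA mulfV ?mul1r ?gt_eqF ?sqrtr_gt0//; congr (_ - _).
rewrite /mxdot mulmx_sumr raddf_sum; apply: eq_bigr => j _ /=.
by rewrite -scalemxAr mxtraceZ.
Qed.

End ConnectionLaplacian.

Theorem mainTheorem4 (R : realType) (n d : nat) (e : rel 'I_n) (w : 'M[R]_n)
    (rho : 'I_n -> 'I_n -> 'M[R]_d)
    (z : 'I_d -> 'cV[R]_(\sum_(i < n) d)) :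
  (0 < d)%N ->
  is_weighted_graph e w ->
  (forall i, 0 < degree w i) ->
  is_connection e rho ->
  0 < eigval (graph_laplacian w) 2 ->
  (forall j k, (z j)^T *m z k = (j == k)%:R%:M) ->
  (forall j : 'I_d, connection_laplacian w rho *m z j =
                    eigval (connection_laplacian w rho) j.+1 *: z j) ->
  let x := fun j => D1_invsqrt d w *m z j in
  let X := block_matrix x in
  let g := fun i => round_orthogonal (X i) in
  frustration w rho g <=
    1026 * d%:R ^+ 3 * (eigval (graph_laplacian w) 2)^-1 *
    \sum_(1 <= i < d.+1) eigval (connection_laplacian w rho) i.
Proof.
move=> d0 graph deg_gt0 conn lam_gt0 z_on z_eig /=.
case: graph => _ e_irr w_sym w_pos w_zero.
have w_ge0 i j : 0 <= w i j.
  by have [/w_pos/ltW//|/w_zero->] := boolP (e i j).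
have w_irr i : w i i = 0 by rewrite w_zero ?e_irr.
have rho_O i j : w i j != 0 -> orthogonal_mx (rho i j).
  by have [/conn[]//|/w_zero->] := boolP (e i j); rewrite eqxx.
have normX := block_matrix_normalized deg_gt0 z_on.
(* On an empty vertex set the normalization would read 0 = 1 for matrices of positive size [d]. *)
have n0 : (0 < n)%N.
  case: (posnP n) => // n0; have /matrixP/(_ (Ordinal d0) (Ordinal d0)) := normX.
  rewrite big1 => [|i]; last by have := ltn_ord i; rewrite {2}n0.
  by rewrite !mxE eqxx => /eqP; rewrite eq_sym oner_eq0.
have vol0 := volume_gt0 deg_gt0 n0.
rewrite big_add1 big_mkord (energy_trace w_sym deg_gt0 rho_O z_on z_eig).
apply: rounding_bound => //.
  by move=> f; apply: poincare.
exact: second_eigenvalue_le2.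
Qed.
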